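(* For every integer $r\ge 3$, the graph $h^r_e$ is ELC-preserved and corresponds to the $[2^r,\,2^r-r-1,\,4]$ extended Hamming code.
   Context: All graphs are finite, simple and undirected. For a graph $G=(V,E)$ and $v\in V$, $N_v$ is the set of vertices adjacent to $v$. Local complementation (LC) on $v$ transforms $G$ into $G*v$ by replacing the induced subgraph of $G$ on $N_v$ by its complement. For an edge $\{u,v\}\in E$, edge local complementation (ELC) on $\{u,v\}$ transforms $G$ into $G^{(u,v)}=G*u*v*u=G*v*u*v$ (operations applied from left to right). $G$ is ELC-preserved if for every edge $\{u,v\}\in E$, $G^{(u,v)}$ is isomorphic to $G$. The graph $h^r$ is the bipartite graph on $2^r-1$ vertices with partitions $U$, of size $r$, and $W$, of size $2^r-r-1$, where $W$ is the disjoint union of sets $W_i$, $2\le i\le r$, with $|W_i|=\binom{r}{i}$; each vertex in $W_i$ is adjacent to exactly $i$ vertices of $U$, and $N_a\ne N_b$ for all distinct $a,b\in W$. The graph $h^r_e$ is the $(r+1,2^r-r-1)$-bipartite graph on $2^r$ vertices obtained from $h^r$ by adding a new vertex adjacent to all vertices of $h^r$ of even degree. An $[n,k,d]$ code is a $k$-dimensional subspace of $\mathbb{F}_2^n$ with minimum distance $d$; two codes are equivalent if one is obtained from the other by a permutation of coordinates. A bipartite graph corresponds to an $[n,k]$ code $\mathcal{C}$ if it is isomorphic to the $(k,n-k)$-bipartite graph with adjacency matrix $\begin{pmatrix}\mathbf{0}_{k\times k}&P\\P^{\mathrm T}&\mathbf{0}_{(n-k)\times(n-k)}\end{pmatrix}$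 for some generator matrix $(I\mid P)$ of a code equivalent to $\mathcal{C}$. (Up to isomorphism, the same graph then also corresponds to the dual code $\mathcal{C}^\perp$, generated up to equivalence by $(P^{\mathrm T}\mid I)$.) *)

(* Defs.v *)
From mathcomp Require Import all_boot all_order all_fingroup all_algebra.

Set Implicit Arguments.
Unset Strict Implicit.
Unset Printing Implicit Defensive.

Import GRing.Theory.
Local Open Scope ring_scope.

Record sgraph (T : finType) := SGraph {
  adj :> rel T;
  adj_sym : symmetric adj;
  adj_irr : irreflexive adj }.

Definition nbr (T : finType) (G : sgraph T) (x : T) : {set T} :=
  [set y | G x y].

Definition deg (T : finType) (G : sgraph T) (x : T) : nat := #|nbr G x|.

Definition isomorphic (T T' : finType) (G : sgraph T) (G' : sgraph T') : Prop :=
  exists2 f : T -> T', bijective f & forall x y, G' (f x) (f y) = G x y.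

Definition lc_rel (T : finType) (G : sgraph T) (v : T) : rel T :=
  fun x y => G x y (+) [&& x != y, x \in nbr G v & y \in nbr G v].

Fact lc_sym (T : finType) (G : sgraph T) (v : T) : symmetric (lc_rel G v).
Proof.
by move=> x y; rewrite /lc_rel adj_sym eq_sym; congr (_ (+) (_ && _)); apply: andbC.
Qed.

Fact lc_irr (T : finType) (G : sgraph T) (v : T) : irreflexive (lc_rel G v).
Proof. by move=> x; rewrite /lc_rel adj_irr eqxx. Qed.

Definition lc (T : finType) (G : sgraph T) (v : T) : sgraph T :=
  SGraph (lc_sym G v) (lc_irr G v).

Definition elc (T : finType) (G : sgraph T) (u v : T) : sgraph T :=
  lc (lc (lc G u) v) u.

Definition elc_preserved (T : finType) (G : sgraph T) : Prop :=
  forall u v : T, G u v -> isomorphic (elc G u v) G.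

Definition independent (T : finType) (G : sgraph T) (A : {set T}) : Prop :=
  {in A &, forall x y, ~~ G x y}.

Definition bipartition (T : finType) (G : sgraph T) (U W : {set T}) : Prop :=
  [/\ U :|: W = [set: T], [disjoint U & W], independent G U & independent G W].

Definition is_h (r : nat) (T : finType) (G : sgraph T) : Prop :=
  #|T| = (2 ^ r - 1)%N /\
  exists (U W : {set T}) (Wi : nat -> {set T}),
    [/\ bipartition G U W, #|U| = r & #|W| = (2 ^ r - r - 1)%N] /\
    [/\ W = \bigcup_(2 <= i < r.+1) Wi i,
        forall i j, (2 <= i <= r)%N -> (2 <= j <= r)%N -> i != j ->
          [disjoint Wi i & Wi j],
        forall i, (2 <= i <= r)%N -> #|Wi i| = 'C(r, i),
        forall i, (2 <= i <= r)%N ->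
          {in Wi i, forall w, #|nbr G w :&: U| = i}
      & {in W &, forall a b, a != b -> nbr G a != nbr G b}].

Definition big_set (r : nat) : finType := {A : {set 'I_r} | (1 < #|A|)%N}.

Definition h_model_rel (r : nat) : rel ('I_r + big_set r) :=
  fun x y => match x, y with
  | inl u, inr A | inr A, inl u => u \in val A
  | _, _ => false
  end.

Fact h_model_sym (r : nat) : symmetric (@h_model_rel r).
Proof. by case=> [u|A] []. Qed.

Fact h_model_irr (r : nat) : irreflexive (@h_model_rel r).
Proof. by case. Qed.

Definition h_model (r : nat) : sgraph ('I_r + big_set r)%type :=
  SGraph (@h_model_sym r) (@h_model_irr r).

Fact card_big_set (r : nat) : #|big_set r| = (2 ^ r - r - 1)%N.
Proof.
have /= cC := cardsC [set A : {set 'I_r} | (1 < #|A|)%N].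
have -> : #|big_set r| = #|[set A : {set 'I_r} | (1 < #|A|)%N]|.
  by rewrite card_sig; apply: eq_card => A; rewrite !inE.
have E : ~: [set A : {set 'I_r} | (1 < #|A|)%N]
         = set0 |: [set A : {set 'I_r} | #|A| == 1%N].
  by apply/setP=> A; rewrite !inE -leqNgt -cards_eq0; case: #|A| => [|[]].
move: cC; rewrite E cardsU1 inE cards0 card_draws card_ord bin1 /=.
have -> : #|{: {set 'I_r}}| = (2 ^ r)%N.
  by rewrite -cardsT -powersetT card_powerset cardsT card_ord.
by move=> <-; rewrite addnA addnK addnK.
Qed.

(* is_h is satisfiable, so a statement quantified over its models is not
   vacuous. *)
Lemma h_model_is_h (r : nat) : is_h r (h_model r).
Proof.
split.
  rewrite card_sum card_ord card_big_set subnAC subnKC //.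
  by rewrite leq_subRL ?expn_gt0 // add1n ltn_expl.
exists [set inl u | u in [set: 'I_r]], [set inr A | A in [set: big_set r]].
exists (fun i => [set inr A | A in [set A : big_set r | #|val A| == i]]).
have inlP u A : (inl u \in [set (inr A : 'I_r + big_set r) | A in A]) = false.
  by apply/imsetP=> -[].
have inrP B A : (inr B \in [set (inl u : 'I_r + big_set r) | u in A]) = false.
  by apply/imsetP=> -[].
have inlI : injective (inl : 'I_r -> 'I_r + big_set r) by move=> ? ? [].
have inrI : injective (inr : big_set r -> 'I_r + big_set r) by move=> ? ? [].
split; split.
- split.
  + by apply/setP=> -[u|A]; rewrite !inE ?(mem_imset _ _ inlI) ?(mem_imset _ _ inrI) !inE ?orbT.
  + by rewrite disjoint_subset; apply/subsetP=> _ /imsetP[u _ ->]; rewrite inE inlP.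
  + by move=> _ _ /imsetP[u _ ->] /imsetP[v _ ->].
  + by move=> _ _ /imsetP[u _ ->] /imsetP[v _ ->].
- by rewrite card_imset // cardsT card_ord.
- by rewrite card_imset // cardsT card_big_set.
- apply/setP=> -[u|A].
    rewrite inlP; apply/esym/negbTE; rewrite big_tnth; apply/bigcupP=> -[i _].
    by rewrite inlP.
  rewrite (mem_imset _ _ inrI) inE; apply/esym.
  have lA : (#|val A| < r.+1)%N by rewrite ltnS -[leqRHS](card_ord r) max_card.
  rewrite (big_cat_nat (n := #|val A|)) ?(valP A) 1?ltnW //=.
  rewrite in_setU [X in _ || X](_ : _ = true) ?orbT //.
  by rewrite big_ltn // in_setU (mem_imset _ _ inrI) inE eqxx.
- move=> i j _ _ nij; rewrite disjoint_subset; apply/subsetP=> _ /imsetP[A Ai ->].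
  by move: Ai; rewrite !inE (mem_imset _ _ inrI) inE => /eqP->.
- move=> i /andP[i2 _]; rewrite card_imset //.
  rewrite -(card_imset _ val_inj) -[in RHS](card_ord r) -card_draws.
  apply: eq_card => A; rewrite inE; apply/imsetP/idP => [[B + ->]|Ai].
    by rewrite inE.
  have lA : (1 < #|A|)%N by rewrite (eqP Ai).
  by exists (exist _ A lA); rewrite ?inE.
- move=> i _ _ /imsetP[A + ->]; rewrite inE => /eqP <-.
  rewrite -(card_imset _ inlI); apply: eq_card => -[u|B].
    by rewrite !inE !(mem_imset _ _ inlI) inE andbT.
  by rewrite !inE inrP.
- move=> _ _ /imsetP[A _ ->] /imsetP[B _ ->]; apply: contraNneq => /setP AB.
  apply/eqP; congr inr; apply/val_inj/setP=> u.
  by have := AB (inl u); rewrite !inE.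
Qed.

Definition even_ext_rel (T : finType) (G : sgraph T) : rel (option T) :=
  fun x y => match x, y with
  | Some a, Some b => G a b
  | Some a, None | None, Some a => ~~ odd (deg G a)
  | None, None => false
  end.

Fact even_ext_sym (T : finType) (G : sgraph T) : symmetric (even_ext_rel G).
Proof. by case=> [x|] [y|] //=; rewrite adj_sym. Qed.

Fact even_ext_irr (T : finType) (G : sgraph T) : irreflexive (even_ext_rel G).
Proof. by case=> [x|] //=; rewrite adj_irr. Qed.

(* If G is h^r then even_ext G is h^r_e: the new vertex is None, and degrees
   are those of G. *)
Definition even_ext (T : finType) (G : sgraph T) : sgraph (option T) :=
  SGraph (even_ext_sym G) (even_ext_irr G).

Definition hdist (n : nat) (x y : 'rV['F_2]_n) : nat :=
  #|[set i | x 0 i != y 0 i]|.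

Definition min_distance (n : nat) (C : {vspace 'rV['F_2]_n}) (d : nat) : Prop :=
  {in C &, forall x y, x != y -> (d <= hdist x y)%N} /\
  exists x y, [/\ x \in C, y \in C, x != y & hdist x y = d].

(* The length is also compared by a proposition, so that a code living in a
   type of row vectors whose length is only provably n can be used. *)
Definition is_code (n k d m : nat) (C : {vspace 'rV['F_2]_m}) : Prop :=
  [/\ m = n, \dim C = k & min_distance C d].

(* A bijection between the coordinate sets stands for a permutation; it forces
   m = n, but spares casts between provably equal lengths. *)
Definition code_equiv (n m : nat)
    (C : {vspace 'rV['F_2]_n}) (D : {vspace 'rV['F_2]_m}) : Prop :=
  exists2 s : 'I_m -> 'I_n, bijective s &
    forall x : 'rV['F_2]_n, (x \in C) = (\row_j x 0 (s j) \in D).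

Definition generator_matrix (k n : nat)
    (M : 'M['F_2]_(k, n)) (C : {vspace 'rV['F_2]_n}) : Prop :=
  row_free M /\ forall x : 'rV['F_2]_n, (x \in C) = (x <= M)%MS.

Definition bip_rel (k l : nat) (P : 'M['F_2]_(k, l)) : rel 'I_(k + l) :=
  fun i j => block_mx 0 P P^T 0 i j == 1.

Fact bip_sym (k l : nat) (P : 'M['F_2]_(k, l)) : symmetric (bip_rel P).
Proof.
move=> i j; rewrite /bip_rel.
by rewrite -[in LHS](trmxK (block_mx _ _ _ _)) mxE tr_block_mx !trmx0 trmxK.
Qed.

Fact bip_irr (k l : nat) (P : 'M['F_2]_(k, l)) : irreflexive (bip_rel P).
Proof.
move=> i; rewrite /bip_rel.
by case: (split_ordP i) => a ->; rewrite ?block_mxEul ?block_mxEdr mxE.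
Qed.

Definition bip_graph (k l : nat) (P : 'M['F_2]_(k, l)) : sgraph 'I_(k + l) :=
  SGraph (bip_sym P) (bip_irr P).

Definition corresponds (T : finType) (G : sgraph T)
    (n : nat) (C : {vspace 'rV['F_2]_n}) : Prop :=
  exists (P : 'M['F_2]_(\dim C, n - \dim C))
         (D : {vspace 'rV['F_2]_(\dim C + (n - \dim C))}),
    [/\ code_equiv C D, generator_matrix (row_mx 1%:M P) D
      & isomorphic G (bip_graph P)].

(* The columns of the parity-check matrix H are the nonzero vectors of F_2^r,
   each once, in any order; this forces n = 2 ^ r - 1. *)
Definition hamming_code (r n : nat) (C : {vspace 'rV['F_2]_n}) : Prop :=
  exists H : 'M['F_2]_(r, n),
    [/\ injective (fun j => col j H),
        forall v : 'cV['F_2]_r, v != 0 <-> exists j, v = col j H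
      & forall x : 'rV['F_2]_n, (x \in C) = (x *m H^T == 0)].

Definition extended_code (n : nat)
    (C : {vspace 'rV['F_2]_n}) (D : {vspace 'rV['F_2]_(n + 1)}) : Prop :=
  forall x : 'rV['F_2]_(n + 1),
    x \in D <-> exists2 c, c \in C & x = row_mx c (const_mx (\sum_i c 0 i)).

Definition extended_hamming_code (r n : nat)
    (D : {vspace 'rV['F_2]_(n + 1)}) : Prop :=
  exists2 C : {vspace 'rV['F_2]_n}, hamming_code r C & extended_code C D.

(* Extended Hamming codes exist for every r. *)
Lemma extended_hamming_code_ex (r : nat) :
  exists (n : nat) (D : {vspace 'rV['F_2]_(n + 1)}), extended_hamming_code r D.
Proof.
pose S := [set v : 'cV['F_2]_r | v != 0].
pose H : 'M['F_2]_(r, #|S|) := \matrix_(i, j) (enum_val j : 'cV_r) i 0.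
have colH j : col j H = enum_val j.
  by apply/colP=> i; rewrite !mxE.
pose f : 'Hom('rV['F_2]_#|S|, 'rV['F_2]_r) := linfun (mulmxr H^T).
pose g : 'Hom('rV['F_2]_#|S|, 'rV['F_2]_(#|S| + 1)) :=
  linfun (mulmxr (row_mx 1%:M (const_mx 1))).
have gE x : g x = row_mx x (const_mx (\sum_i x 0 i)).
  rewrite lfunE /= mul_mx_row mulmx1; congr row_mx.
  by apply/matrixP=> i j; rewrite !mxE ord1; apply: eq_bigr => k _; rewrite mxE mulr1.
exists #|S|, (g @: lker f)%VS, (lker f).
  exists H; split=> [j1 j2 /=|v|x].
  - by rewrite !colH; apply: enum_val_inj.
  - split=> [v0|[j ->]]; last first.
      by rewrite colH; have := enum_valP j; rewrite inE.
    have Sv : v \in S by rewrite inE.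
    by exists (enum_rank_in Sv v); rewrite colH enum_rankK_in.
  - by rewrite memv_ker lfunE.
move=> x; split=> [/memv_imgP[c Cc ->]|[c Cc ->]].
  by exists c; rewrite ?gE.
by rewrite -gE memv_img.
Qed.

(* Main.v *)
Require Import Defs.
From mathcomp Require Import all_boot all_order all_fingroup all_algebra.

(** Label the 2^r vertices of h^r_e by the vectors of odd weight in
F_2^(r+1), of which there are 2^r as well: the r + 1 vertices on the side of U
(U and the added vertex) get the unit vectors, and a vertex of W gets the
characteristic vector of its neighbourhood. The added vertex is there precisely
to make all these neighbourhoods odd; no label is repeated because vertices of
W have distinct neighbourhoods, of size at least 2 in U. Adjacency is then the
relation fund_rel on labels: x and y are adjacent when one of them is a unit
vector e_i and the other is not a unit vector and has i-th coordinate 1. Hence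
any two graphs with such a labelling are isomorphic (labels_iso).

In matroid terms the odd-weight vectors are the points of the binary affine
geometry AG(r, 2), the unit vectors are a base of it, and fund_rel is the
fundamental graph of that base. Edge local complementation on an edge uv
exchanges u and v in the base. On labels this is the linear involution
x |-> x + x_i (w + e_i), where e_i and w are the labels of u and v: it exchanges
e_i and w and preserves the parity of the weight. So the new labels
again enumerate the odd vectors and describe the new graph (labels_elc_basis),
and the new graph is isomorphic to the old one.

On the side of codes, adding an overall parity check to the check matrix of a
Hamming code and changing the basis of the dual code yields a check matrix whose
columns are exactly the odd-weight vectors (extended_hamming_odd_check).
Dimension and minimum distance follow: the columns span, an odd number of them
never adds up to 0, two distinct ones do not either, but four may. Permuting the
columns so that the unit vectors come last gives the check matrix (P^T | I),
hence the generator matrix (I | P), and the rows of P and I label the vertices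
of the bipartite graph of P by odd vectors (labels_bip). Both graphs carry a
labelling, so they are isomorphic. *)

Set Implicit Arguments.
Unset Strict Implicit.
Unset Printing Implicit Defensive.

Import GRing.Theory.
Local Open Scope ring_scope.

(** * Arithmetic modulo 2 *)

Lemma F2_cases (a : 'F_2) : a = 0 \/ a = 1.
Proof. by case: a => -[|[|//]] ?; [left | right]; apply/val_inj. Qed.

Lemma F2_eq1D (a b : 'F_2) : (a + b == 1) = (a == 1) (+) (b == 1).
Proof. by case: (F2_cases a) => ->; case: (F2_cases b) => ->. Qed.

Lemma F2_eq1M (a b : 'F_2) : (a * b == 1) = (a == 1) && (b == 1).
Proof. by case: (F2_cases a) => ->; case: (F2_cases b) => ->. Qed.

Lemma F2_natr_eq0 (n : nat) : (n%:R == 0 :> 'F_2) = ~~ odd n.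
Proof. by rewrite -dvdn2 (dvdn_pcharf (pchar_Fp (isT : prime 2))). Qed.

Lemma F2_natr_eq1 (n : nat) : (n%:R == 1 :> 'F_2) = odd n.
Proof.
apply/idP/idP=> [/eqP n1|on]; first by rewrite -[odd n]negbK -F2_natr_eq0 n1.
have: n%:R != 0 :> 'F_2 by rewrite F2_natr_eq0 on.
by case: (F2_cases n%:R) => ->.
Qed.

Lemma F2_addvv (a : 'F_2) : a + a = 0.
Proof. by case: (F2_cases a) => ->; apply/val_inj. Qed.

Lemma F2_mx_addvv m n (A : 'M['F_2]_(m, n)) : A + A = 0.
Proof. by apply/matrixP=> i j; rewrite !mxE F2_addvv. Qed.

Lemma F2_mx_addr_eq0 m n (A B : 'M['F_2]_(m, n)) : (A + B == 0) = (A == B).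
Proof.
by rewrite -(inj_eq (addIr B)) -addrA F2_mx_addvv addr0 add0r.
Qed.

(** * Vectors of odd weight *)

Definition parity m (v : 'rV['F_2]_m) : 'F_2 := \sum_i v 0 i.

Lemma parityD m (v w : 'rV['F_2]_m) : parity (v + w) = parity v + parity w.
Proof. by rewrite /parity -big_split; apply: eq_bigr => i _; rewrite mxE. Qed.

Lemma parity0 m : parity (0 : 'rV['F_2]_m) = 0.
Proof. by rewrite /parity big1 // => i _; rewrite mxE. Qed.

Lemma parityZ m a (v : 'rV['F_2]_m) : parity (a *: v) = a * parity v.
Proof. by rewrite /parity mulr_sumr; apply: eq_bigr => i _; rewrite mxE. Qed.

Local Notation e_ i := (delta_mx 0 i : 'rV['F_2]_ _).

Lemma basisE m (i j : 'I_m) : (e_ i) 0 j = (j == i)%:R.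
Proof. by rewrite mxE. Qed.

Lemma basis_inj m : injective (fun i : 'I_m => e_ i).
Proof.
by move=> i j /rowP/(_ i); rewrite !basisE eqxx; case: eqP.
Qed.

Lemma parity_basis m (i : 'I_m) : parity (e_ i) = 1.
Proof.
rewrite /parity (bigD1 i) //= basisE eqxx big1 ?addr0 // => j /negbTE ji.
by rewrite basisE ji.
Qed.

(** Prepending a parity bit identifies F_2^r with the odd-weight vectors of
F_2^(r+1); it also turns the columns of a Hamming check matrix into
odd-weight columns. *)
Definition parity_ext r (v : 'rV['F_2]_r) : 'rV['F_2]_r.+1 :=
  row_mx (const_mx (1 + parity v) : 'rV_1) v.

Lemma parity_row_mx m n (a : 'rV['F_2]_m) (b : 'rV['F_2]_n) :
  parity (row_mx a b) = parity a + parity b.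
Proof.
rewrite /parity big_split_ord /=; congr (_ + _); apply: eq_bigr => i _.
  by rewrite row_mxEl.
by rewrite row_mxEr.
Qed.

Lemma parity1 (a : 'rV['F_2]_1) : parity a = a 0 0.
Proof. by rewrite /parity big_ord1. Qed.

Lemma parity_ext_odd r (v : 'rV['F_2]_r) : parity (parity_ext v) = 1.
Proof.
by rewrite (parity_row_mx (m := 1)) parity1 mxE -addrA F2_addvv addr0.
Qed.

Lemma parity_ext_inj r : injective (@parity_ext r).
Proof.
move=> v w vw.
by have [] := eq_row_mx (vw : @row_mx _ 1 1 r _ _ = row_mx _ _).
Qed.

Lemma rsubmx_parity_ext r (v : 'rV['F_2]_r) :
  rsubmx (parity_ext v : 'rV_(1 + r)) = v.
Proof. exact: row_mxKr. Qed.

Lemma parity_extK r (v : 'rV['F_2]_r.+1) :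
  parity v = 1 -> parity_ext (rsubmx (v : 'rV_(1 + r))) = v.
Proof.
pose v' : 'rV_(1 + r) := v; rewrite -[v]/v' => v1.
have vE := parity_row_mx (lsubmx v') (rsubmx v').
rewrite hsubmxK [LHS]v1 parity1 in vE.
suff lE : const_mx (1 + parity (rsubmx v')) = lsubmx v'.
  by rewrite -[RHS](hsubmxK v') -lE.
apply/matrixP=> i j; rewrite !ord1 mxE vE.
by rewrite -addrA F2_addvv addr0.
Qed.

Definition odd_vecs m : {set 'rV['F_2]_m} := [set v | parity v == 1].

Lemma card_odd_vecs r : #|odd_vecs r.+1| = (2 ^ r)%N.
Proof.
have -> : odd_vecs r.+1 = [set parity_ext v | v in [set: 'rV['F_2]_r]].
  apply/setP=> v; rewrite inE; apply/eqP/imsetP => [v1|[w _ ->]].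
    by exists (rsubmx (v : 'rV_(1 + r))); rewrite ?parity_extK.
  exact: parity_ext_odd.
by rewrite card_imset ?cardsT ?card_mx ?card_Fp ?mul1n //; apply: parity_ext_inj.
Qed.

Definition enumerates (T : finType) m (c : T -> 'rV['F_2]_m) : Prop :=
  injective c /\ codom c =i odd_vecs m.

Lemma enumerates_odd (T : finType) m (c : T -> 'rV['F_2]_m) x :
  enumerates c -> parity (c x) = 1.
Proof. by case=> _ cE; have := codom_f c x; rewrite cE inE => /eqP. Qed.

Lemma enumerates_onto (T : finType) m (c : T -> 'rV['F_2]_m) v :
  enumerates c -> parity v = 1 -> exists x, c x = v.
Proof.
case=> _ cE v1; have /codomP[x ->] : v \in codom c by rewrite cE inE v1.
by exists x.
Qed.

Lemma enumerates_card (T : finType) r (c : T -> 'rV['F_2]_r.+1) :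
  enumerates c -> #|T| = (2 ^ r)%N.
Proof.
by case=> c_inj cE; rewrite -card_odd_vecs -(card_codom c_inj); apply: eq_card.
Qed.

Lemma enumerates_inj_card (T : finType) r (c : T -> 'rV['F_2]_r.+1) :
  injective c -> (forall x, parity (c x) = 1) -> #|T| = (2 ^ r)%N ->
  enumerates c.
Proof.
move=> c_inj c1 cT; split=> //; apply/subset_cardP.
  by rewrite card_codom // cT card_odd_vecs.
by apply/subsetP=> _ /codomP[x ->]; rewrite inE c1.
Qed.

Lemma enumerates_match (T T' : finType) m
    (c : T -> 'rV['F_2]_m) (c' : T' -> 'rV['F_2]_m) :
  enumerates c -> enumerates c' ->
  exists2 f : T -> T', bijective f & forall x, c' (f x) = c x.
Proof.
move=> [cI cE] [cI' cE'].
have cc' x : c x \in codom c' by rewrite cE' -cE codom_f.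
have c'c y : c' y \in codom c by rewrite cE -cE' codom_f.
exists (fun x => iinv (cc' x)) => [|x]; last exact: f_iinv.
exists (fun y => iinv (c'c y)) => [x|y].
  by apply: cI; rewrite !f_iinv.
by apply: cI'; rewrite !f_iinv.
Qed.

(** * The adjacency relation on odd vectors *)

(** Both terms can hold only if x and y are the same unit vector, and the
exclusive disjunction makes fund_rel false there. *)
Definition fund_rel m : rel 'rV['F_2]_m := fun x y =>
  [exists i, (x == e_ i) && (y 0 i == 1)]
  (+) [exists i, (y == e_ i) && (x 0 i == 1)].

Definition is_basis m (x : 'rV['F_2]_m) : bool := [exists i, x == e_ i].

Lemma fund_relC m : symmetric (@fund_rel m).
Proof. by move=> x y; rewrite /fund_rel addbC. Qed.

Lemma fund_rel_irr m : irreflexive (@fund_rel m).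
Proof. by move=> x; rewrite /fund_rel addbb. Qed.

Lemma fund_rel_basis m (j : 'I_m) z :
  fund_rel (e_ j) z = (z != e_ j) && (z 0 j == 1).
Proof.
have -> : (z != e_ j) && (z 0 j == 1) = (z 0 j == 1) (+) (z == e_ j).
  by case: eqVneq => [->|_]; rewrite ?basisE ?eqxx ?addbF.
congr (_ (+) _); apply/existsP/idP => [[i]|].
- by case/andP=> /eqP/basis_inj ->.
- by move=> zj; exists j; rewrite eqxx.
- by case/andP=> /eqP->; rewrite basisE; case: (eqVneq i j) => [->|].
- by move=> zj; exists j; rewrite zj basisE eqxx.
Qed.

Lemma fund_rel_nonbasis m (x y : 'rV['F_2]_m) :
  ~~ is_basis x -> ~~ is_basis y -> fund_rel x y = false.
Proof.
have no_row (z t : 'rV_m) : ~~ is_basis z ->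
    [exists i, (z == e_ i) && (t 0 i == 1)] = false.
  move=> nz; apply/existsP=> -[i /andP[zi _]].
  by case/existsP: nz; exists i.
by move=> nx ny; rewrite /fund_rel !no_row.
Qed.

Definition labels (T : finType) (G : sgraph T) m (c : T -> 'rV['F_2]_m) :=
  enumerates c /\ forall x y, G x y = fund_rel (c x) (c y).

(** The labels carry all the information on the graph, and both labellings have
the same range. *)
Lemma labels_iso (T T' : finType) (G : sgraph T) (G' : sgraph T') m
    (c : T -> 'rV['F_2]_m) (c' : T' -> 'rV['F_2]_m) :
  labels G c -> labels G' c' -> isomorphic G G'.
Proof.
move=> [cT GE] [cT' GE']; have [f f_bij fE] := enumerates_match cT cT'.
by exists f => // x y; rewrite GE GE' !fE.
Qed.

(** * Edge local complementation *)

(** Without any bipartiteness assumption, complementing on an edge uv exchanges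
the neighbourhoods of u and v outside the edge, and toggles a pair outside the
edge exactly when the traces of the two neighbourhoods on {u, v} are
distinct and nonempty, which is the 2 x 2 determinant of elc_away. *)
Section Elc.
Variables (T : finType) (G : sgraph T) (u v : T).
Hypothesis Guv : G u v.

Let Gvu : G v u. Proof. by rewrite adj_sym. Qed.

Let uvF : (u == v = false) * (v == u = false).
Proof.
have uv : u != v by apply: contraTneq Guv => ->; rewrite adj_irr.
by rewrite [v == u]eq_sym (negbTE uv).
Qed.

Let neqE (x y : T) : x != y -> (x == y = false) * (y == x = false).
Proof. by move=> xy; rewrite [y == x]eq_sym (negbTE xy). Qed.

Let elcE x y : elc G u v x y = lc_rel (lc (lc G u) v) u x y.
Proof. by []. Qed.

Lemma elc_endpoints : elc G u v u v.
Proof.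
do 3! rewrite ?elcE /= /lc_rel ?inE /=.
by rewrite !adj_irr Guv Gvu !eqxx !uvF.
Qed.

Lemma elc_left y : y != u -> y != v -> elc G u v u y = G v y.
Proof.
move=> /neqE yu /neqE yv; do 3! rewrite ?elcE /= /lc_rel ?inE /=.
rewrite !adj_irr Guv Gvu ?eqxx !(uvF, yu, yv) /=.
by case: (G u y); case: (G v y).
Qed.

Lemma elc_right y : y != u -> y != v -> elc G u v v y = G u y.
Proof.
move=> /neqE yu /neqE yv; do 3! rewrite ?elcE /= /lc_rel ?inE /=.
rewrite !adj_irr Guv Gvu ?eqxx !(uvF, yu, yv) /=.
by case: (G u y); case: (G v y).
Qed.

Lemma elc_away x y : x != u -> x != v -> y != u -> y != v -> x != y ->
  elc G u v x y = G x y (+) (G u x && G v y (+) G v x && G u y).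
Proof.
move=> /neqE xu /neqE xv /neqE yu /neqE yv /neqE xy.
do 3! rewrite ?elcE /= /lc_rel ?inE /=.
rewrite !adj_irr Guv Gvu ?eqxx !(uvF, xu, xv, yu, yv, xy) /=.
by case: (G u x); case: (G v x); case: (G u y); case: (G v y); case: (G x y).
Qed.
End Elc.

(** The formulas above are symmetric in u and v. This makes it possible to assume
that the first end of the edge is the one labelled by a unit vector. *)
Lemma elcC (T : finType) (G : sgraph T) u v : G u v -> elc G u v =2 elc G v u.
Proof.
move=> Guv; have Gvu : G v u by rewrite adj_sym.
have sub x y : x \in [set u; v] -> elc G u v x y = elc G v u x y.
  move=> /set2P xuv; case: (eqVneq x y) => [->|nxy]; first by rewrite !adj_irr.
  case: xuv => xE; subst x; rewrite eq_sym in nxy.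
    case: (eqVneq y v) => [->|yv].
      by rewrite elc_endpoints // adj_sym elc_endpoints.
    by rewrite elc_left ?elc_right.
  case: (eqVneq y u) => [->|yu].
    by rewrite adj_sym !elc_endpoints.
  by rewrite elc_left ?elc_right.
move=> x y; case: (boolP (x \in [set u; v])) => [|]; first exact: sub.
case: (boolP (y \in [set u; v])) => [yuv _|].
  by rewrite adj_sym sub // adj_sym.
rewrite !inE !negb_or => /andP[yu yv] /andP[xu xv].
case: (eqVneq x y) => [->|nxy]; first by rewrite !adj_irr.
by rewrite !elc_away //; congr (_ (+) _); apply: addbC.
Qed.

(** The transvection that exchanges e_i and w, for a vector w with i-th
coordinate 1: a change of base in which w replaces e_i. *)
Definition pivot m (i : 'I_m) (w x : 'rV['F_2]_m) : 'rV['F_2]_m :=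
  x + x 0 i *: (w + e_ i).

Section Pivot.
Variables (m : nat) (i : 'I_m) (w : 'rV['F_2]_m).
Hypothesis wi : w 0 i = 1.

Lemma pivot_coord (x : 'rV_m) : pivot i w x 0 i = x 0 i.
Proof.
by rewrite !mxE wi !eqxx F2_addvv mulr0 addr0.
Qed.

Lemma pivotK : involutive (pivot i w).
Proof.
by move=> x; rewrite {1}/pivot pivot_coord /pivot -addrA F2_mx_addvv addr0.
Qed.

Lemma pivot_fix (x : 'rV_m) : x 0 i = 0 -> pivot i w x = x.
Proof. by rewrite /pivot => ->; rewrite scale0r addr0. Qed.

Lemma pivot_basis : pivot i w (e_ i) = w.
Proof. by rewrite /pivot basisE eqxx scale1r addrCA F2_mx_addvv addr0. Qed.

Lemma pivot_w : pivot i w w = e_ i.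
Proof. by rewrite /pivot wi scale1r addrA F2_mx_addvv add0r. Qed.

Lemma pivot_parity (x : 'rV_m) : parity w = 1 -> parity (pivot i w x) = parity x.
Proof.
move=> w1; rewrite parityD parityZ parityD w1 parity_basis.
by rewrite F2_addvv mulr0 addr0.
Qed.

(** The only new unit vector among the images is that of w. *)
Lemma pivot_is_basis (x : 'rV_m) : x != w ->
  is_basis (pivot i w x) -> is_basis x.
Proof.
move=> xw /existsP[j /eqP pxj]; apply/existsP; exists j; apply/eqP.
rewrite -[LHS]pivotK pxj; case: (eqVneq i j) => [ij|ij].
  by move: xw; rewrite -[x]pivotK pxj -ij pivot_basis eqxx.
by rewrite pivot_fix // basisE (negbTE ij).
Qed.
End Pivot.

(** The pivot fixes the unit vectors other than e_i, so the new base consists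
of v and of the old base without u. For x labelled by such an e_j and y outside
the base, adjacency is the j-th coordinate of the label of y; the pivot adds to
it y_i w_j, which is the term added by elc_away. *)
Lemma labels_elc_basis (T : finType) (G : sgraph T) m (c : T -> 'rV['F_2]_m)
    (u v : T) (i : 'I_m) :
  labels G c -> G u v -> c u = e_ i -> labels (elc G u v) (pivot i (c v) \o c).
Proof.
move=> [cT GE] Guv cu; have [c_inj cE] := cT.
have /andP[vi /eqP cvi] : (c v != e_ i) && (c v 0 i == 1).
  by rewrite -fund_rel_basis -cu -GE.
have pK := pivotK cvi.
split.
  split=> [|z]; first exact: inj_comp (inv_inj pK) c_inj.
  have -> : (z \in codom (pivot i (c v) \o c)) = (pivot i (c v) z \in codom c).
    apply/codomP/codomP => -[x xE]; exists x; first by rewrite xE /= pK.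
    by rewrite /= -xE pK.
  by rewrite cE !inE pivot_parity ?(enumerates_odd v cT).
have compE z : (pivot i (c v) \o c) z = pivot i (c v) (c z) by [].
have nbv : ~~ is_basis (c v).
  apply/existsP=> -[j /eqP vj]; move: cvi vi; rewrite vj basisE.
  by case: (eqVneq i j) => // ->; rewrite eqxx.
have cu_neq y : y != u -> c y != e_ i by rewrite -cu (inj_eq c_inj).
have cv_neq y : y != v -> c y != c v by rewrite (inj_eq c_inj).
have nbp y : y != u -> y != v -> ~~ is_basis (c y) ->
    ~~ is_basis (pivot i (c v) (c y)).
  by move=> _ /cv_neq yv; apply: contraNN; apply: pivot_is_basis.
have fixb y j : y != u -> c y = e_ j -> pivot i (c v) (c y) = e_ j.
  move=> /cu_neq yu yj; rewrite pivot_fix // yj basisE.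
  by move: yu; rewrite yj; case: (eqVneq i j) => // ->; rewrite eqxx.
have sub x y : x \in [set u; v] ->
    elc G u v x y = fund_rel (pivot i (c v) (c x)) (pivot i (c v) (c y)).
  move=> /set2P xuv; case: (eqVneq x y) => [->|nxy].
    by rewrite adj_irr fund_rel_irr.
  have uvE : fund_rel (pivot i (c v) (c u)) (pivot i (c v) (c v)).
    by rewrite cu pivot_basis pivot_w // fund_relC fund_rel_basis vi cvi eqxx.
  case: xuv => xE; subst x.
    case: (eqVneq y v) => [->|yv]; first by rewrite elc_endpoints ?uvE.
    have yu : y != u by rewrite eq_sym.
    rewrite elc_left // GE cu pivot_basis.
    case: (boolP (is_basis (c y))) => [/existsP[j /eqP yj]|nby].
      by rewrite (fixb _ _ yu yj) yj.
    by rewrite !fund_rel_nonbasis // nbp.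
  case: (eqVneq y u) => [->|yu].
    by rewrite adj_sym elc_endpoints // fund_relC uvE.
  have yv : y != v by rewrite eq_sym.
  rewrite elc_right // GE cu pivot_w // !fund_rel_basis pivot_coord //.
  by rewrite cu_neq // -(pivot_w cvi) (inj_eq (inv_inj pK)) cv_neq.
move=> x y; rewrite ![(_ \o _) _]compE.
case: (boolP (x \in [set u; v])) => [|]; first exact: sub.
case: (boolP (y \in [set u; v])) => [yuv _|].
  by rewrite adj_sym sub // fund_relC.
rewrite !inE !negb_or => /andP[yu yv] /andP[xu xv].
case: (eqVneq x y) => [->|nxy]; first by rewrite adj_irr fund_rel_irr.
have basis_row x' y' j : x' != u -> x' != v -> y' != u -> y' != v -> x' != y' ->
    c x' = e_ j ->
    elc G u v x' y' = fund_rel (pivot i (c v) (c x')) (pivot i (c v) (c y')).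
  move=> xu' xv' yu' yv' nxy' xj; have ji : i != j.
    by have := cu_neq _ xu'; rewrite xj; case: (eqVneq i j) => // ->; rewrite eqxx.
  have nyj : c y' != e_ j by rewrite -xj (inj_eq c_inj) eq_sym.
  rewrite elc_away // !GE (fixb _ _ xu' xj) xj cu (fund_relC (c v) (e_ j)).
  rewrite !fund_rel_basis.
  rewrite nyj (cu_neq _ yu') basisE (negbTE ji) andbF /=.
  have -> : pivot i (c v) (c y') != e_ j.
    by rewrite -(fixb _ _ xu' xj) (inj_eq (inv_inj pK)) eq_sym (inj_eq c_inj).
  have -> : c v != e_ j by rewrite -xj (inj_eq c_inj) eq_sym.
  by rewrite !mxE (eq_sym j) (negbTE ji) andbF addr0 F2_eq1D F2_eq1M /= andbC.
case: (boolP (is_basis (c x))) => [/existsP[j /eqP xj]|nbx].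
  exact: basis_row xj.
case: (boolP (is_basis (c y))) => [/existsP[j /eqP yj]|nby].
  by rewrite adj_sym fund_relC; apply: (basis_row _ _ j) => //; rewrite eq_sym.
rewrite elc_away // !GE (fund_rel_nonbasis nbx nby).
by rewrite !(fund_rel_nonbasis nbv) // andbF (fund_rel_nonbasis (nbp _ xu xv nbx)) ?nbp.
Qed.

Lemma elc_preserved_labels (T : finType) (G : sgraph T) m
    (c : T -> 'rV['F_2]_m) :
  labels G c -> elc_preserved G.
Proof.
move=> Gc u v Guv; have [_ GE] := Gc.
have [/existsP[i /eqP ui]|nu] := boolP (is_basis (c u)).
  exact: labels_iso (labels_elc_basis Gc Guv ui) Gc.
have [/existsP[i /eqP vi]|nv] := boolP (is_basis (c v)); last first.
  by move: Guv; rewrite GE fund_rel_nonbasis.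
have Gvu : G v u by rewrite adj_sym.
have [cT elcE] := labels_elc_basis Gc Gvu vi.
apply: labels_iso Gc; split; first exact: cT.
by move=> x y; rewrite elcC.
Qed.

(** * Labelling a bipartite graph by neighbourhoods *)

Section LabelBipartite.
Variables (T : finType) (G : sgraph T) (r : nat) (b : 'I_r.+1 -> T).
Hypothesis b_inj : injective b.
Hypothesis indep_in : forall i j, G (b i) (b j) = false.
Hypothesis indep_out : forall x y,
  x \notin codom b -> y \notin codom b -> G x y = false.
Hypothesis nbrs_odd : forall x, x \notin codom b -> odd (\sum_i G x (b i)).
Hypothesis nbrs_gt1 : forall x, x \notin codom b -> (1 < \sum_i G x (b i))%N.
Hypothesis nbrs_inj : forall x y, x \notin codom b -> y \notin codom b ->
  (forall i, G x (b i) = G y (b i)) -> x = y.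
Hypothesis cardT : #|T| = (2 ^ r)%N.

(** The diagonal term x == b i only matters on the side of b, which is
independent: there it gives the unit vectors, elsewhere the row is the
neighbourhood. *)
Definition closed_row x : 'rV['F_2]_r.+1 :=
  \row_i ((x == b i) || G x (b i))%:R.

Lemma closed_row_in j : closed_row (b j) = e_ j.
Proof.
by apply/rowP=> i; rewrite !mxE indep_in orbF (inj_eq b_inj) eq_sym.
Qed.

Lemma closed_row_out x i : x \notin codom b -> closed_row x 0 i = (G x (b i))%:R.
Proof.
by rewrite mxE; case: eqP => [->|//]; rewrite codom_f.
Qed.

Lemma closed_row_nonbasis x : x \notin codom b -> ~~ is_basis (closed_row x).
Proof.
move=> xb; apply: contraL (nbrs_gt1 xb) => /existsP[j /eqP xj].
rewrite -leqNgt (bigD1 j) //= big1 ?addn0 ?leq_b1 // => i /negbTE ij.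
by have := closed_row_out i xb; rewrite xj basisE ij; case: (G x (b i)).
Qed.

(** The count of vertices makes the injective labelling onto. *)
Lemma labels_closed_row : labels G closed_row.
Proof.
split; last first.
  have in_row j y : G (b j) y = fund_rel (closed_row (b j)) (closed_row y).
    rewrite closed_row_in fund_rel_basis.
    case: (boolP (y \in codom b)) => [/codomP[k ->]|yb].
      rewrite indep_in closed_row_in basisE.
      by case: (eqVneq j k) => [->|]; rewrite ?eqxx ?andbF.
    have -> : closed_row y != e_ j.
      by apply: contraNN (closed_row_nonbasis yb) => yj; apply/existsP; exists j.
    by rewrite closed_row_out // adj_sym; case: (G y (b j)).
  move=> x y; case: (boolP (x \in codom b)) => [/codomP[j ->] //|xb].
  case: (boolP (y \in codom b)) => [/codomP[j ->]|yb].
    by rewrite adj_sym fund_relC.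
  by rewrite indep_out // fund_rel_nonbasis ?closed_row_nonbasis.
have basisP x : is_basis (closed_row x) = (x \in codom b).
  case: (boolP (x \in codom b)) => [/codomP[j ->]|xb].
    by rewrite closed_row_in; apply/existsP; exists j.
  exact/negbTE/closed_row_nonbasis.
apply: enumerates_inj_card => // [x y xy|x].
  have := basisP x; rewrite xy basisP => xyb.
  case: (boolP (x \in codom b)) => xb.
    move: xb (xb); rewrite -{2}xyb => /codomP[i xi] /codomP[j yj].
    by move: xy; rewrite xi yj !closed_row_in => /basis_inj->.
  have yb : y \notin codom b by rewrite xyb.
  apply: nbrs_inj => // i; have /rowP/(_ i) := xy; rewrite !closed_row_out //.
  by case: (G x (b i)); case: (G y (b i)).
case: (boolP (x \in codom b)) => [/codomP[j ->]|xb].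
  by rewrite closed_row_in parity_basis.
apply/eqP; rewrite /parity; under eq_bigr => i _ do rewrite closed_row_out //.
by rewrite -natr_sum F2_natr_eq1 nbrs_odd.
Qed.
End LabelBipartite.

(** * The labelling of h^r_e *)

(** This is the degree in h^r of a vertex of U, which must be odd for the added
vertex to be adjacent to vertices of W only. Removing i is a bijection to the
nonempty subsets of the complement of i, of which there are 2^(r-1) - 1. *)
Lemma odd_card_big_sets_through r (i : 'I_r) : (1 < r)%N ->
  odd #|[set A : {set 'I_r} | (i \in A) && (1 < #|A|)%N]|.
Proof.
move=> r1; suff -> : [set A : {set 'I_r} | (i \in A) && (1 < #|A|)%N]
    = [set i |: B | B in powerset [set~ i] :\ set0].
  rewrite card_in_imset => [|A B]; last first.
    have notin (D : {set 'I_r}) : D \subset [set~ i] -> i \notin D.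
      by rewrite subsetC sub1set inE.
    rewrite !inE => /andP[_ /notin Ai] /andP[_ /notin Bi] AB.
    by rewrite -(setU1K Ai) AB setU1K.
  have := cardsD1 set0 (powerset [set~ i]).
  rewrite powersetE sub0set card_powerset cardsC1 card_ord.
  move=> /(congr1 odd); rewrite oddX oddD orbF eqn0Ngt -subn1 subn_gt0 r1 /=.
  by case: (odd _).
apply/setP=> A; rewrite inE; apply/andP/imsetP => [[iA A1]|[B]].
  exists (A :\ i); last by rewrite setD1K.
  rewrite !inE subsetDr -card_gt0 andbT; move: A1.
  by rewrite (cardsD1 i A) iA.
rewrite !inE -card_gt0 => /andP[B0 /subsetP Bi] ->.
rewrite setU11 cardsU1 [i \notin B](_ : _ = true) //.
by apply: contraT => /negPn/Bi; rewrite !inE eqxx.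
Qed.

(** Counting shows that the neighbourhoods of the vertices of W are all the
subsets of U with at least two elements; the degrees of U follow. *)
Lemma labels_even_ext r (T : finType) (G : sgraph T) :
  (1 < r)%N -> is_h r G ->
  exists c : option T -> 'rV['F_2]_r.+1, labels (even_ext G) c.
Proof.
move=> r1 [cardT [U [W [Wi [[[UW disUW indU indW] cU cW] [WE _ _ cWi N_inj]]]]]].
subst r; set r := #|U| in r1 cardT cW WE cWi *.
have WU w : (w \in W) = (w \notin U).
  move: disUW; rewrite disjoint_subset => /subsetP UnW.
  have := in_setT w; rewrite -UW inE; case: (boolP (w \in U)) => [/UnW|//].
  by rewrite inE => /negbTE.
have cWU : {in W, forall w, 1 < #|nbr G w :&: U|}%N.
  rewrite WE big_nat.
  apply: (big_ind (fun S : {set T} =>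
    {in S, forall w, 1 < #|nbr G w :&: U|}%N)).
  - by move=> w; rewrite inE.
  - by move=> A B hA hB w; rewrite inE => /orP[/hA|/hB].
  - by move=> i ri w wi; rewrite (cWi i) //; case/andP: ri.
pose be : 'I_r -> T := enum_val.
have be_inj : injective be by exact: enum_val_inj.
have beU i : be i \in U by exact: enum_valP.
have Ube u : u \in U -> exists i, u = be i.
  by move=> uU; exists (enum_rank_in uU u); rewrite /be enum_rankK_in.
have nbrU w : w \in W -> nbr G w \subset U.
  move=> wW; apply/subsetP=> y; rewrite inE => wy; apply: contraTT wy => yU.
  by apply: indW => //; rewrite WU.
have sum_deg w : w \in W -> (\sum_i G w (be i))%N = deg G w.
  move=> wW; rewrite /deg -sum1_card (big_mkcond (mem (nbr G w))) /=.
  rewrite (bigID (mem U)) /= [X in (_ + X)%N]big1 ?addn0; last first.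
    by move=> y yU; case: ifP => // /(subsetP (nbrU _ wW)); rewrite (negbTE yU).
  by rewrite [RHS]big_enum_val; apply: eq_bigr => i _; rewrite inE /be; case: (G _ _).
(* Transported to 'I_r, the neighbourhoods can be compared with big_set r. *)
pose A w := [set i | G w (be i)].
have A_nbr w : w \in W -> nbr G w = be @: A w.
  move=> wW; apply/setP=> y; apply/idP/imsetP => [wy|[i]]; last first.
    by rewrite !inE => ? ->.
  have [i yi] := Ube _ (subsetP (nbrU _ wW) _ wy).
  by exists i => //; rewrite inE -yi; rewrite inE in wy.
have cA w : w \in W -> #|A w| = deg G w.
  by move=> wW; rewrite /deg A_nbr // card_imset.
have deg1 w : w \in W -> (1 < deg G w)%N.
  by move=> wW; rewrite /deg; have := cWU _ wW; rewrite (setIidPl (nbrU _ wW)).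
have A_inj : {in W &, injective A}.
  move=> w w' wW w'W ww'; apply/eqP; apply: contraT => /(N_inj _ _ wW w'W).
  by rewrite !A_nbr // ww' eqxx.
have A_onto : A @: W = [set B : {set 'I_r} | (1 < #|B|)%N].
  apply/eqP; rewrite eqEcard card_in_imset // cW -card_big_set card_sig.
  apply/andP; split.
    by apply/subsetP=> _ /imsetP[w wW ->]; rewrite inE cA // deg1.
  by apply/eq_leq/eq_card => B; rewrite !inE.
have degU i : odd (deg G (be i)).
  have nbrE : nbr G (be i) = [set w in W | i \in A w].
    apply/setP=> w; rewrite !inE adj_sym WU; case: (boolP (w \in U)) => //= wU.
    exact/negbTE/indU.
  have -> : deg G (be i) = #|A @: [set w in W | i \in A w]|.
    rewrite /deg nbrE card_in_imset // => w w' /[!inE] /andP[wW _] /andP[w'W _].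
    exact: A_inj.
  have -> : A @: [set w in W | i \in A w]
      = [set B : {set 'I_r} | (i \in B) && (1 < #|B|)%N].
    apply/setP=> B; apply/imsetP/idP => [[w + ->]|].
      by rewrite !inE => /andP[wW ->]; rewrite cA // deg1.
    rewrite inE => /andP[iB B1]; have : B \in A @: W by rewrite A_onto inE.
    by case/imsetP=> w wW BE; exists w; rewrite // inE wW -BE.
  exact: odd_card_big_sets_through.
(* Index 0 is the added vertex. *)
pose b (i : 'I_r.+1) : option T := omap be (unlift ord0 i).
have b0 : b ord0 = None by rewrite /b unlift_none.
have bS i : b (lift ord0 i) = Some (be i) by rewrite /b liftK.
have b_codom x : (x \in codom b) = if x is Some y then y \in U else true.
  apply/codomP/idP => [[i ->]|].
    by case: (unliftP ord0 i) => [j|] ->; rewrite ?b0 ?bS.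
  case: x => [y /Ube[i ->]|_]; first by exists (lift ord0 i).
  by exists ord0.
exists (closed_row (even_ext G) b); apply: labels_closed_row.
- by move=> i j; case: (unliftP ord0 i) => [i'|] ->; case: (unliftP ord0 j) => [j'|] ->;
    rewrite ?b0 ?bS // => -[/be_inj->].
- move=> i j; case: (unliftP ord0 i) => [i'|] ->; case: (unliftP ord0 j) => [j'|] ->;
    rewrite ?b0 ?bS //= ?degU //.
  exact/negbTE/indU.
- move=> [x|] [y|]; rewrite !b_codom //= -!WU => xW yW; exact/negbTE/indW.
- move=> [w|]; rewrite b_codom //= -WU => wW; rewrite big_ord_recl b0 /=.
  under eq_bigr => i _ do rewrite bS /=.
  by rewrite sum_deg // oddD oddb; case: (odd _).
- move=> [w|]; rewrite b_codom //= -WU => wW; rewrite big_ord_recl b0 /=.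
  under eq_bigr => i _ do rewrite bS /=.
  by rewrite sum_deg // ltn_addl ?deg1.
- move=> [x|] [y|]; rewrite !b_codom //= -!WU => xW yW xy; congr Some.
  apply: A_inj => //; apply/setP=> i; rewrite !inE.
  by have := xy (lift ord0 i); rewrite bS.
- by rewrite card_option cardT subn1 prednK ?expn_gt0.
Qed.

(** * The bipartite graph of a systematic generator matrix *)

Lemma odd_nonbasis_card r k : (k + r.+1 = 2 ^ r)%N ->
  #|odd_vecs r.+1 :\: [set e_ i | i in 'I_r.+1]| = k.
Proof.
move=> kr; apply/eqP; rewrite -(eqn_add2r r.+1) kr -card_odd_vecs.
rewrite -(cardsID [set e_ i | i in 'I_r.+1] (odd_vecs r.+1)) addnC eqn_add2r.
rewrite (setIidPr _) ?card_imset ?card_ord //; first exact: basis_inj.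
by apply/subsetP=> _ /imsetP[i _ ->]; rewrite inE parity_basis.
Qed.

Lemma odd_systematic r k : (k + r.+1 = 2 ^ r)%N ->
  exists P : 'M['F_2]_(k, r.+1), enumerates (fun i => row i (col_mx P 1%:M)).
Proof.
move=> kr; have := odd_nonbasis_card kr; set S := _ :\: _ => cS; subst k.
pose P : 'M['F_2]_(#|S|, r.+1) := \matrix_i enum_val i.
have PE i : row i P = enum_val i by rewrite rowK.
have PS i : row i P \in S by rewrite PE enum_valP.
exists P; apply: enumerates_inj_card; last by rewrite card_ord.
  have PN i j : row i P != e_ j.
    have := PS i; rewrite inE => /andP[+ _]; apply: contraNneq => ->.
    exact: imset_f.
  move=> i j; case: (split_ordP i) => [i'|i'] ->; case: (split_ordP j) => [j'|j'] ->.
  - by rewrite !rowKu !PE => /enum_val_inj->.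
  - by rewrite rowKu rowKd row1 => /eqP; rewrite (negbTE (PN _ _)).
  - by rewrite rowKu rowKd row1 => /esym/eqP; rewrite (negbTE (PN _ _)).
  - by rewrite !rowKd !row1 => /basis_inj->.
move=> i; case: (split_ordP i) => i' ->.
  by rewrite rowKu; have := PS i'; rewrite !inE => /andP[_ /eqP].
by rewrite rowKd row1 parity_basis.
Qed.

Lemma labels_bip k m (P : 'M['F_2]_(k, m)) :
  enumerates (fun i => row i (col_mx P 1%:M)) ->
  labels (bip_graph P) (fun i => row i (col_mx P 1%:M)).
Proof.
move=> Penum; split=> // i j; have [P_inj _] := Penum.
have PN i' j' : row i' P != e_ j'.
  rewrite -row1 -(rowKu _ P 1%:M) -(rowKd _ P 1%:M); apply/eqP=> /P_inj/eqP.
  by rewrite eq_lrshift.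
have nb i' : ~~ is_basis (row i' P).
  by apply/existsP=> -[j' /eqP/eqP]; rewrite (negbTE (PN _ _)).
rewrite /= /bip_rel.
case: (split_ordP i) => [i'|i'] ->; case: (split_ordP j) => [j'|j'] ->.
- by rewrite block_mxEul mxE !rowKu fund_rel_nonbasis.
- by rewrite block_mxEur rowKu rowKd row1 fund_relC fund_rel_basis PN mxE.
- by rewrite block_mxEdl rowKu rowKd row1 fund_rel_basis PN !mxE.
- rewrite block_mxEdr mxE !rowKd !row1 fund_rel_basis basisE.
  by case: (eqVneq i' j') => [->|]; rewrite ?eqxx ?andbF.
Qed.

(** * Codes whose check matrix lists the odd vectors *)

Lemma mul_row_matrix N m (q : 'I_N -> 'rV['F_2]_m) x :
  x *m (\matrix_i q i) = \sum_(i | x 0 i == 1) q i.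
Proof.
rewrite mulmx_sum_row [RHS]big_mkcond; apply: eq_bigr => i _; rewrite rowK.
by case: (F2_cases (x 0 i)) => ->; rewrite ?scale0r ?scale1r.
Qed.

Lemma parity_sum (I : finType) (p : pred I) m (q : I -> 'rV['F_2]_m) :
  (forall i, parity (q i) = 1) -> parity (\sum_(i | p i) q i) = #|p|%:R.
Proof.
move=> q1; rewrite /parity; under eq_bigr => j _ do rewrite summxE.
rewrite exchange_big /= -sum1_card natr_sum; apply: eq_bigr => i _.
exact: q1.
Qed.

Section OddParityCheck.
Variables (r N : nat) (q : 'I_N -> 'rV['F_2]_r.+1) (C : {vspace 'rV['F_2]_N}).
Hypothesis q_enum : enumerates q.
Hypothesis CE : forall x, (x \in C) = (x *m (\matrix_i q i) == 0).

Let q_odd i : parity (q i) = 1. Proof. exact: enumerates_odd q_enum. Qed.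

Lemma length_odd_check : N = (2 ^ r)%N.
Proof. by rewrite -(enumerates_card q_enum) card_ord. Qed.

(** The columns of the check matrix contain the unit vectors, so the syndrome
map is onto F_2^(r+1). *)
Lemma dim_odd_check : (\dim C + r.+1 = N)%N.
Proof.
pose f : 'Hom('rV['F_2]_N, 'rV['F_2]_r.+1) := linfun (mulmxr (\matrix_i q i)).
have -> : C = lker f by apply/vspaceP=> x; rewrite CE memv_ker lfunE.
have f_onto : limg f = fullv.
  apply/vspaceP=> v; rewrite memvf (row_sum_delta v).
  apply: memv_suml => i _; apply: memvZ.
  have [j qj] := enumerates_onto q_enum (parity_basis i).
  rewrite -qj -(rowK q j) rowE; have := memv_img f (memvf (delta_mx 0 j)).
  by rewrite lfunE.
have := limg_ker_dim f fullv; rewrite capfv f_onto !dimvf /dim /=.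
by rewrite !mul1n.
Qed.

(** An odd number of odd vectors has an odd sum, which is not 0. *)
Lemma even_check (x : 'rV_N) : x \in C -> ~~ odd #|[set i | x 0%R i == 1%R]|.
Proof.
rewrite CE mul_row_matrix => /eqP x0.
by rewrite -F2_natr_eq0 cardsE -(parity_sum _ q_odd) x0 parity0.
Qed.

Lemma weight_odd_check (x : 'rV_N) :
  x \in C -> x != 0 -> (3 < #|[set i | x 0%R i == 1%R]|)%N.
Proof.
move=> xC nx; have := even_check xC.
move: xC; rewrite CE mul_row_matrix.
set S := [set i | _].
have SE (i : 'I_N) : (i \in S) = (x 0 i == 1) by rewrite inE.
under eq_bigl => i do rewrite -SE.
have S0 : S != set0.
  apply: contraNneq nx => /setP S0; apply/eqP/rowP=> i; rewrite mxE.
  by have := S0 i; rewrite SE inE; case: (F2_cases (x 0 i)) => ->.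
rewrite -card_gt0 in S0; move=> qS evS.
have S2 : #|S| != 2.
  apply: contraTN qS => /cards2P[i [j [ij ->]]].
  rewrite big_setU1 ?inE //= big_set1 F2_mx_addr_eq0.
  by case: q_enum => q_inj _; rewrite (inj_eq q_inj).
by move: #|S| S0 S2 evS => [|[|[|[|]]]].
Qed.

(** The fourth column is the sum of three unit vectors, which is again odd. *)
Lemma weight4_odd_check : (1 < r)%N ->
  exists2 x, x \in C & #|[set i | x 0%R i == 1%R]| = 4.
Proof.
move=> r1; pose i0 : 'I_r.+1 := ord0.
have [q_inj _] := q_enum.
pose i1 : 'I_r.+1 := inord 1; pose i2 : 'I_r.+1 := inord 2.
have i1E : i1 = 1%N :> nat by rewrite inordK // ltnS ltnW.
have i2E : i2 = 2 :> nat by rewrite inordK.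
have i01 : (i0 == i1) = false by rewrite -val_eqE /= i1E.
have i02 : (i0 == i2) = false by rewrite -val_eqE /= i2E.
have i12 : (i1 == i2) = false by rewrite -val_eqE /= i1E i2E.
pose t := e_ i0 + (e_ i1 + e_ i2).
have t1 : parity t = 1 by rewrite !parityD !parity_basis F2_addvv addr0.
have [a qa] := enumerates_onto q_enum (parity_basis i0).
have [b qb] := enumerates_onto q_enum (parity_basis i1).
have [c qc] := enumerates_onto q_enum (parity_basis i2).
have [d qd] := enumerates_onto q_enum t1.
pose s := [:: a; b; c; d].
have tN i : t != e_ i.
  apply/eqP=> /rowP t_i; have := t_i i0; have := t_i i1.
  rewrite !mxE !eqxx !(eq_sym i1 i0) i01 i02 i12 /=.
  case: (eqVneq i1 i) => [<-|//] _; first by rewrite i01.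
have s_uniq : uniq s.
  rewrite -(map_inj_uniq q_inj) /= qa qb qc qd !inE !negb_or !(eq_sym _ t) !tN.
  by rewrite !(inj_eq (@basis_inj _)) i01 i02 i12.
pose x : 'rV['F_2]_N := \row_i (i \in s)%:R.
have xE (i : 'I_N) : (x 0 i == 1) = (i \in s) by rewrite mxE; case: (i \in s).
exists x.
  rewrite CE mul_row_matrix; under eq_bigl => i do rewrite xE.
  rewrite -big_uniq //= !big_cons big_nil qa qb qc qd addr0.
  by rewrite (addrA (e_ i1)) addrA F2_mx_addvv eqxx.
have -> : [set i | x 0%R i == 1%R] = [set i in s] by apply/setP=> i; rewrite !inE xE !inE.
by rewrite cardsE (card_uniqP s_uniq).
Qed.

Lemma is_code_odd_check : (1 < r)%N -> is_code (2 ^ r) (2 ^ r - r - 1) 4 C.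
Proof.
move=> r1; split; first exact: length_odd_check.
  rewrite -[X in (X - r - 1)%N]length_odd_check -subnDA addn1.
  by rewrite -[X in (X - _)%N]dim_odd_check addnK.
have hdistE (x y : 'rV['F_2]_N) : hdist x y = #|[set i | (x + y)%R 0%R i == 1%R]|.
  apply: eq_card => i; rewrite !inE mxE.
  by case: (F2_cases (x 0 i)) => ->; case: (F2_cases (y 0 i)) => ->.
split=> [x y xC yC xy|].
  by rewrite hdistE weight_odd_check ?memvD // F2_mx_addr_eq0.
have [x xC x4] := weight4_odd_check r1.
exists x, 0; rewrite mem0v hdistE addr0; split=> //.
apply: contraTneq isT => x0; move: x4; rewrite x0.
by rewrite (eq_card (B := pred0)) ?card0 // => i; rewrite !inE mxE.
Qed.

(** The permutation of coordinates matches the odd columns of the two check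
matrices; since -1 = 1, the code with check matrix (P^T | I) is generated by
(I | P). *)
Lemma corresponds_odd_check (T : finType) (G : sgraph T)
    (c : T -> 'rV['F_2]_r.+1) :
  labels G c -> corresponds G C.
Proof.
move=> Gc; have codim : (N - \dim C = r.+1)%N by rewrite -{1}dim_odd_check addKn.
have dimN : (\dim C + r.+1 = 2 ^ r)%N by rewrite dim_odd_check length_odd_check.
(* The dimension of C also occurs in the types of P and D. *)
rewrite /corresponds codim; move: (\dim C) dimN => k kr.
have [P Penum] := odd_systematic kr.
have [s s_bij qs] := enumerates_match Penum q_enum.
pose Q := col_mx P 1%:M.
pose D := lker (linfun (mulmxr Q) : 'Hom('rV['F_2]_(k + r.+1), 'rV['F_2]_r.+1)).
have DE x : (x \in D) = (x *m Q == 0) by rewrite memv_ker lfunE.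
exists P, D; split; last exact: labels_iso Gc (labels_bip Penum).
  exists s => // x; rewrite CE DE; congr (_ == 0).
  rewrite !mulmx_sum_row (reindex s) /=; last exact: onW_bij.
  by apply: eq_bigr => i _; rewrite rowK qs !mxE.
split.
  apply/row_freeP; exists (col_mx 1%:M 0).
  by rewrite mul_row_col mulmx1 mulmx0 addr0.
move=> x; rewrite DE -[x]hsubmxK mul_row_col mulmx1 F2_mx_addr_eq0.
apply/eqP/submxP => [xE|[y]].
  by exists (lsubmx x); rewrite mul_mx_row mulmx1 xE.
by rewrite mul_mx_row mulmx1 => /eq_row_mx[-> ->].
Qed.
End OddParityCheck.

(** * Extended Hamming codes *)

(** The columns of H are the nonzero vectors; the extra coordinate accounts for
the zero vector. Prepending a parity bit to each column gives the odd vectors.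
The sum of all the coordinates of a syndrome is the overall parity check, and its
last r coordinates are the syndrome for H. *)
Lemma extended_hamming_odd_check r n (C : {vspace 'rV['F_2]_(n + 1)}) :
  extended_hamming_code r C ->
  exists2 q : 'I_(n + 1) -> 'rV['F_2]_r.+1, enumerates q &
    forall x, (x \in C) = (x *m (\matrix_i q i) == 0).
Proof.
move=> [C0 [H [H_inj H_onto C0E] CE]].
pose h i := row i (col_mx H^T (0 : 'M_(1, r))).
have hl j : h (lshift 1 j) = (col j H)^T by rewrite /h rowKu tr_col.
have hr j : h (rshift n j) = 0 by rewrite /h rowKd row0.
have colN0 j : col j H != 0 by apply/H_onto; exists j.
have h_inj : injective h.
  move=> i j; case: (split_ordP i) => [i'|i'] ->; case: (split_ordP j) => [j'|j'] ->.
  - by rewrite !hl => /trmx_inj/H_inj->.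
  - by rewrite hl hr -trmx0 => /trmx_inj/eqP; rewrite (negbTE (colN0 _)).
  - by rewrite hl hr -trmx0 => /trmx_inj/esym/eqP; rewrite (negbTE (colN0 _)).
  - by rewrite !ord1.
have h_onto v : exists i, h i = v.
  case: (eqVneq v 0) => [->|v0]; first by exists (rshift n 0).
  have /H_onto[j vj] : v^T != 0 by rewrite -trmx0 (inj_eq (@trmx_inj _ _ _)).
  by exists (lshift 1 j); rewrite hl -vj trmxK.
pose q i := parity_ext (h i).
have q1 i : parity (q i) = 1 by exact: parity_ext_odd.
exists q.
  split=> [i j /parity_ext_inj/h_inj //|v].
  rewrite inE; apply/codomP/eqP => [[i ->] //|v1].
  have [i hi] := h_onto (rsubmx (v : 'rV_(1 + r))).
  by exists i; rewrite /q hi parity_extK.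
have zeroE (v : 'rV['F_2]_(1 + r)) : (v == 0) = (parity v == 0) && (rsubmx v == 0).
  rewrite -{1 2}[v]hsubmxK parity_row_mx parity1.
  apply/eqP/andP => [|[/eqP p0 /eqP v0]].
    rewrite -row_mx0 => /eq_row_mx[-> ->].
    by rewrite parity0 mxE addr0.
  rewrite v0 -row_mx0; congr row_mx; apply/matrixP=> i j.
  by move: p0; rewrite !ord1 v0 parity0 addr0 => ->; rewrite mxE.
have rsub x : rsubmx (x *m (\matrix_i q i) : 'rV_(1 + r)) = lsubmx x *m H^T.
  rewrite -[x in LHS]hsubmxK.
  have -> : lsubmx x *m H^T = x *m col_mx H^T 0.
    by rewrite -{2}[x]hsubmxK mul_row_col mulmx0 addr0.
  rewrite hsubmxK; apply/rowP=> j; rewrite !mxE; apply: eq_bigr => i _.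
  have /rowP/(_ j) := rsubmx_parity_ext (h i).
  by rewrite !mxE => <-.
have par x : parity (x *m (\matrix_i q i)) = parity (lsubmx x) + x 0 (rshift n 0).
  rewrite mul_row_matrix parity_sum // -sum1_card natr_sum big_mkcond.
  transitivity (parity x).
    by apply: eq_bigr => i _; rewrite -topredE /=; case: (F2_cases (x 0 i)) => ->.
  by rewrite -{1}[x]hsubmxK parity_row_mx parity1 !mxE.
move=> x; rewrite (zeroE (x *m _)) rsub par.
apply/idP/andP => [/CE[c cC ->]|[/eqP p0 cH]].
  by rewrite row_mxKl row_mxEr mxE /parity F2_addvv eqxx -C0E.
apply/CE; exists (lsubmx x); first by rewrite C0E.
rewrite -{1}[x]hsubmxK; congr row_mx; apply/matrixP=> i j; rewrite !ord1 !mxE.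
by apply/eqP; rewrite eq_sym -(inj_eq (addIr (x 0 (rshift n 0)))) F2_addvv; apply/eqP.
Qed.

Theorem theorem6 (r : nat) (hr : (3 <= r)%N)
    (T : finType) (G : sgraph T) (hG : is_h r G) :
  elc_preserved (even_ext G) /\
  forall (n : nat) (C : {vspace 'rV['F_2]_(n + 1)}),
    extended_hamming_code r C ->
    is_code (2 ^ r) (2 ^ r - r - 1) 4 C /\ corresponds (even_ext G) C.
Proof.
have r1 : (1 < r)%N by exact: ltnW.
have [c Gc] := labels_even_ext r1 hG.
split=> [|n C /extended_hamming_odd_check[q q_enum CE]].
  exact: elc_preserved_labels Gc.
by split; [apply: is_code_odd_check CE r1 | apply: corresponds_odd_check CE _ _ _ Gc].
Qed.
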